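(* Let $p>1$ and let $\mathcal{E}_p:\mathbb{P}(2n)\to\mathbb{R}$ be defined by $$\mathcal{E}_p(A)=\sum_{j=1}^n\frac{1}{1-p}\log_2\left(\frac{2^p}{(d_j(A)+1)^p-(d_j(A)-1)^p}\right)\quad\text{for }A\in\mathbb{G}(2n),$$ and $\mathcal{E}_p(A)=0$ for $A\in\mathbb{P}(2n)\setminus\mathbb{G}(2n)$. Then $\mathcal{E}_p$ is Fréchet differentiable on $\mathbb{G}^\circ(2n)$, and its gradient at $A\in\mathbb{G}^\circ(2n)$ is given by $$\nabla\mathcal{E}_p(A)=\tfrac12\,M D_{w(A)}M^\top$$ for any choice of $M\in\mathrm{SP}^\uparrow(2n,A)$, where $w(A)\in\mathbb{R}^n$ has entries $$w_j(A)=\frac{p}{(p-1)\ln2}\cdot\frac{(d_j(A)+1)^{p-1}-(d_j(A)-1)^{p-1}}{(d_j(A)+1)^p-(d_j(A)-1)^p},\qquad 1\le j\le n.$$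
   Context: $n$ is a positive integer and $\mathbb{R}^n_{++}$ is the set of vectors in $\mathbb{R}^n$ with strictly positive entries. $\mathbb{S}(2n)$ is the space of real symmetric $2n\times 2n$ matrices with inner product $\langle A,B\rangle=\operatorname{Tr}(A^\top B)$ and the induced (Frobenius) norm; $\mathbb{P}(2n)\subset\mathbb{S}(2n)$ is the open subset of positive definite matrices. Gradients of real functions on $\mathbb{P}(2n)$ are elements of $\mathbb{S}(2n)$. For $x\in\mathbb{R}^n$, $D_x:=\operatorname{Diag}(x)\oplus\operatorname{Diag}(x)$. A real $2n\times 2n$ matrix $M$ is symplectic if $M^\top JM=J$ with $J=\begin{pmatrix}0&I_n\\-I_n&0\end{pmatrix}$. By Williamson's theorem, for each $A\in\mathbb{P}(2n)$ there is a unique vector $d(A)=(d_1(A),\dots,d_n(A))\in\mathbb{R}^n_{++}$ with $d_1(A)\le\cdots\le d_n(A)$ such that $M^\top AM=D_{d(A)}$ for some symplectic $M$. $\mathrm{SP}^\uparrow(2n,A)$ denotes the set of all symplectic $M$ with $M^\top AM=D_{d(A)}$. $\mathbb{G}(2n)=\{A\in\mathbb{P}(2n): d_j(A)\ge1\ \forall j\}$ is the set of covariance matrices of $n$-mode bosonic Gaussian states, and $\mathbb{G}^\circ(2n)$ is its interior, consisting of the $A\in\mathbb{P}(2n)$ with $d_j(A)>1$ for all $j$ (covariance matrices of faithful Gaussian states). $\mathcal{E}_p$ is the Rényi entropy as a function of the covariance matrix. *)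

(* Defs.v *)
From HB Require Import structures.
From mathcomp Require Import all_boot all_order all_algebra.
From mathcomp Require Import all_classical all_reals all_analysis.
From mathcomp Require Import ring lra.

Set Implicit Arguments.
Unset Strict Implicit.
Unset Printing Implicit Defensive.

Import Order.TTheory GRing.Theory Num.Theory.
Import numFieldNormedType.Exports.

Local Open Scope classical_set_scope.
Local Open Scope ring_scope.

(* The space of real symmetric m x m matrices, as a subspace of 'M[R]_m. It is
   normed below by the Frobenius norm, not by the sup norm of 'M[R]_m. *)
Definition issym (R : realType) (m : nat) : {pred 'M[R]_m} :=
  fun A => A^T == A.

Record symmx (R : realType) (m : nat) :=
  SymMx { symval :> 'M[R]_m; _ : symval \in @issym R m }.

HB.instance Definition _ (R : realType) (m : nat) :=
  [isSub for @symval R m].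
HB.instance Definition _ (R : realType) (m : nat) :=
  [Choice of symmx R m by <:].

Lemma issym_submod_closed (R : realType) (m : nat) : submod_closed (@issym R m).
Proof.
split=> [|c A B]; rewrite /issym !unfold_in ?trmx0 //.
by move=> /eqP symA /eqP symB; rewrite linearP /= symA symB.
Qed.

HB.instance Definition _ (R : realType) (m : nat) :=
  GRing.isSubmodClosed.Build R 'M[R]_m (@issym R m) (issym_submod_closed R m).
HB.instance Definition _ (R : realType) (m : nat) :=
  [SubChoice_isSubLmodule of symmx R m by <:].

Definition inner (R : realType) (m : nat) (A B : symmx R m) : R :=
  \tr ((A : 'M[R]_m)^T *m B).

Definition frobenius (R : realType) (m : nat) (A : symmx R m) : R :=
  Num.sqrt (inner A A).

Section Frobenius.
Variables (R : realType) (m : nat).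
Implicit Types (A B C : symmx R m) (c : R).

Lemma innerC A B : inner A B = inner B A.
Proof. by rewrite /inner -mxtrace_tr trmx_mul trmxK. Qed.

Lemma innerDr A B C : inner A (B + C) = inner A B + inner A C.
Proof. by rewrite /inner /= mulmxDr mxtraceD. Qed.

Lemma innerZr c A B : inner A (c *: B) = c * inner A B.
Proof. by rewrite /inner /= -scalemxAr mxtraceZ. Qed.

Lemma innerDl A B C : inner (B + C) A = inner B A + inner C A.
Proof. by rewrite innerC innerDr !(innerC A). Qed.

Lemma innerZl c A B : inner (c *: A) B = c * inner A B.
Proof. by rewrite innerC innerZr (innerC B). Qed.

Lemma innerE A : inner A A = \sum_i \sum_j (A : 'M[R]_m) j i ^+ 2.
Proof.
rewrite /inner /mxtrace; apply: eq_bigr => i _; rewrite mxE.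
by apply: eq_bigr => j _; rewrite mxE expr2.
Qed.

Lemma inner_ge0 A : 0 <= inner A A.
Proof.
by rewrite innerE; do 2 apply: sumr_ge0 => ? _; apply: sqr_ge0.
Qed.

Lemma inner_eq0 A : inner A A = 0 -> A = 0.
Proof.
have sq_ge0 i : 0 <= \sum_j (A : 'M[R]_m) j i ^+ 2.
  by apply: sumr_ge0 => j _; apply: sqr_ge0.
rewrite innerE => /psumr_eq0P A0; apply: val_inj; apply/matrixP => j i /=.
have /psumr_eq0P Ai0 := A0 (fun i _ => sq_ge0 i) i isT.
have /eqP := Ai0 (fun j _ => sqr_ge0 _) j isT.
by rewrite sqrf_eq0 mxE => /eqP.
Qed.

Lemma inner_cauchy A B : inner A B ^+ 2 <= inner A A * inner B B.
Proof.
have [/inner_eq0 ->|B0] := eqVneq (inner B B) 0.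
  by rewrite -(scale0r 0) !innerZr !mul0r mulr0 expr2 mul0r.
have B_gt0 : 0 < inner B B by rewrite lt_def B0 inner_ge0.
have := inner_ge0 (inner B B *: A + (- inner A B) *: B).
rewrite !(innerDl, innerDr, innerZl, innerZr) (innerC B A) => h.
rewrite -subr_ge0 -(pmulr_rge0 _ B_gt0); apply: le_trans h _.
by rewrite le_eqVlt; apply/orP; left; apply/eqP; ring.
Qed.

Lemma frobeniusD A B : frobenius (A + B) <= frobenius A + frobenius B.
Proof.
rewrite /frobenius -[leRHS]ger0_norm ?addr_ge0 ?sqrtr_ge0 //.
rewrite -sqrtr_sqr ler_wsqrtr // sqrrD !sqr_sqrtr ?inner_ge0 //.
rewrite !(innerDl, innerDr) (innerC B A).
suff : inner A B <= Num.sqrt (inner A A) * Num.sqrt (inner B B) by lra.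
rewrite -sqrtrM ?inner_ge0 //; apply: le_trans (ler_norm _) _.
by rewrite -sqrtr_sqr ler_wsqrtr // inner_cauchy.
Qed.

Lemma frobeniusZ c A : frobenius (c *: A) = `|c| * frobenius A.
Proof.
by rewrite /frobenius innerZl innerZr mulrA -expr2 sqrtrM ?sqr_ge0 // sqrtr_sqr.
Qed.

Lemma frobenius_eq0 A : frobenius A = 0 -> A = 0.
Proof.
move=> /eqP; rewrite sqrtr_eq0 => A_le0; apply: inner_eq0; apply/eqP.
by rewrite eq_le A_le0 inner_ge0.
Qed.

End Frobenius.

HB.instance Definition _ (R : realType) (m : nat) :=
  Lmodule_isNormed.Build R (symmx R m)
    (@frobeniusD R m) (@frobeniusZ R m) (@frobenius_eq0 R m).

Definition is_gradient (R : realType) (m : nat) (f : symmx R m -> R^o)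
    (A G : symmx R m) : Prop :=
  is_diff A f (fun H => inner G H : R^o).

Lemma is_gradient_unique (R : realType) (m : nat) (f : symmx R m -> R^o)
    (A G G' : symmx R m) :
  is_gradient f A G -> is_gradient f A G' -> G = G'.
Proof.
move=> dG dG'; apply/eqP; rewrite -subr_eq0; apply/eqP/inner_eq0.
have GG' : (fun H => inner G H : R^o) = (fun H => inner G' H : R^o).
  by rewrite -(@diff_val _ _ _ _ _ _ _ dG) -(@diff_val _ _ _ _ _ _ _ dG').
have /= eGG' := congr1 (fun h => h (G - G')) GG'.
by apply: (addIr (inner G' (G - G'))); rewrite add0r -innerDl subrK.
Qed.

Definition posdef (R : realType) (m : nat) : set (symmx R m) :=
  [set A | forall x : 'cV[R]_m, x != 0 -> 0 < (x^T *m (A : 'M[R]_m) *m x) 0 0].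

Definition Jmx (R : realType) (n : nat) : 'M[R]_(n + n) :=
  block_mx 0 1%:M (- 1%:M) 0.

Definition symplectic (R : realType) (n : nat) : set 'M[R]_(n + n) :=
  [set M | M^T *m Jmx R n *m M = Jmx R n].

Definition Dmx (R : realType) (n : nat) (x : 'rV[R]_n) : 'M[R]_(n + n) :=
  block_mx (diag_mx x) 0 0 (diag_mx x).

Definition is_symp_spectrum (R : realType) (n : nat) (A : symmx R (n + n))
    (d : 'rV[R]_n) : Prop :=
  [/\ forall j, 0 < d 0 j,
      forall i j : 'I_n, (i <= j)%N -> d 0 i <= d 0 j &
      exists2 M, symplectic M & M^T *m (A : 'M[R]_(n + n)) *m M = Dmx d].

(* For positive definite A this is the unique vector given by Williamson's
   theorem; the default value 0 is only taken when there is no such vector. *)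
Definition symp_spectrum (R : realType) (n : nat) (A : symmx R (n + n)) :
  'rV[R]_n := xget 0 (is_symp_spectrum A).

Definition SPup (R : realType) (n : nat) (A : symmx R (n + n)) :
    set 'M[R]_(n + n) :=
  [set M | symplectic M /\
    M^T *m (A : 'M[R]_(n + n)) *m M = Dmx (symp_spectrum A)].

Definition gaussian (R : realType) (n : nat) : set (symmx R (n + n)) :=
  [set A | posdef A /\ forall j, 1 <= symp_spectrum A 0 j].

Arguments gaussian : clear implicits.

Definition log2 (R : realType) (x : R) : R := ln x / ln 2.

(* Extended by 0 to all symmetric matrices; the values outside the open set of
   positive definite matrices do not affect differentiability on it. *)
Definition renyi (R : realType) (n : nat) (p : R) (A : symmx R (n + n)) : R^o :=
  if A \in gaussian R n then
    let d := symp_spectrum A in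
    \sum_(j < n) 1 / (1 - p) *
      log2 (2 `^ p / ((d 0 j + 1) `^ p - (d 0 j - 1) `^ p))
  else 0.

Definition renyi_weight (R : realType) (n : nat) (p : R) (A : symmx R (n + n)) :
    'rV[R]_n :=
  let d := symp_spectrum A in
  \row_j (p / ((p - 1) * ln 2) *
    (((d 0 j + 1) `^ (p - 1) - (d 0 j - 1) `^ (p - 1)) /
     ((d 0 j + 1) `^ p - (d 0 j - 1) `^ p))).

(* Main.v *)
(**
For X(B) = - (J B)^2, a symplectic M with M^T B M = D_d conjugates X(B) to
diag(d^2, d^2), so tr q(X(B)) / 2 = sum_j q(d_j(B)^2) for every polynomial q.
Write E_p(B) = sum_j g(d_j(B)), and let q be a Hermite interpolant: the maps
t |-> q(t^2) and g agree to first order at every d_k(A).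
The polynomial function tr q(X(B)) / 2 has the announced gradient at A, and
the rest, sum_j (g(d_j(B)) - q(d_j(B)^2)), is o(|B - A|): by the Bauer-Fike
argument each d_j(B)^2 lies within C |B - A| of some d_k(A)^2, whatever the
multiplicities.  Williamson's theorem is never needed: for n > 0 the condition
d_j >= 1 excludes the default value 0 of the symplectic spectrum.  In the
interior d_j(A) > 1, because (1 - e) A still satisfies d_j >= 1.
*)

Require Import Defs.
From HB Require Import structures.
From mathcomp Require Import all_boot all_order all_algebra.
From mathcomp Require Import all_classical all_reals all_analysis.
From mathcomp Require Import ring lra.

Set Implicit Arguments.
Unset Strict Implicit.
Unset Printing Implicit Defensive.

Import Order.TTheory GRing.Theory Num.Theory.
Import numFieldNormedType.Exports.

Local Open Scope classical_set_scope.
Local Open Scope ring_scope.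

(** * Hermite interpolation and eigenvalue perturbation *)

(** Induction on the nodes: a multiple of the squared nodal polynomial corrects value and slope at a
    new node and leaves both unchanged at the earlier ones. A repeated node is skipped, so
    coinciding eigenvalues do no harm. *)
Lemma hermite_interpolation (F : fieldType) (s : seq F) (a b : F -> F) :
  exists q : {poly F}, {in s, forall x, q.[x] = a x /\ q^`().[x] = b x}.
Proof.
elim: s => [|y s [q qab]]; first by exists 0.
have [ys|ys] := boolP (y \in s).
  by exists q => x; rewrite inE => /predU1P [->|]; apply: qab.
pose v : {poly F} := (\prod_(x <- s) ('X - x%:P)) ^+ 2.
have rv x : x \in s -> v.[x] = 0 /\ v^`().[x] = 0.
  move=> xs; have r0 : (\prod_(x <- s) ('X - x%:P)).[x] = 0.
    by apply/rootP; rewrite root_prod_XsubC.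
  by rewrite /v expr2 derivM !hornerE !r0 !mulr0 !mul0r addr0.
have v_neq0 : v.[y] != 0.
  rewrite /v horner_exp expf_neq0 // -[_ == _]/(root _ y).
  by rewrite root_prod_XsubC.
(* [c] and [e] solve the value equation and then the slope equation at [y]. *)
move: v rv v_neq0 => v rv v_neq0; pose c := (a y - q.[y]) / v.[y].
pose e := (b y - q^`().[y] - c * v^`().[y]) / v.[y].
exists (q + (c%:P + e%:P * ('X - y%:P)) * v) => x.
rewrite !poly.derivE !hornerE inE => /predU1P [->|xs].
  rewrite !subrr !mulr0 !addr0 ?mul0r ?add0r ?mulr1 /c /e !divfK //.
  by rewrite /=; split; [ring|rewrite /c; ring].
have [-> ->] := rv x xs; have [-> ->] := qab x xs.
by rewrite /= !mulr0 !addr0.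
Qed.

Lemma horner_mx_diagonal (F : fieldType) (m : nat) (X P : 'M[F]_m.+1)
    (l : 'rV[F]_m.+1) (q : {poly F}) :
  X *m P = P *m diag_mx l ->
  horner_mx X q *m P = P *m diag_mx (map_mx (horner q) l).
Proof.
move=> XP; rewrite -horner_mx_diag.
elim/poly_ind: q => [|q c IH]; first by rewrite !rmorph0 mul0mx mulmx0.
rewrite !rmorphD !rmorphM /= !horner_mx_X !horner_mx_C mulmxDl mulmxDr.
by rewrite -!mulmxE -mulmxA XP mulmxA IH -mulmxA scalar_mxC.
Qed.

(** The bound involves the eigenbasis [P] of [Y] but not [Q]. Later [Y] is fixed and [X] tends to
    it, so the estimate is uniform in [X]. *)
Lemma bauer_fike (R : realFieldType) (m : nat) (X Y P Q : 'M[R]_m)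
    (l mu : 'rV[R]_m) (i : 'I_m) :
  P \in unitmx -> Q \in unitmx ->
  Y *m P = P *m diag_mx l -> X *m Q = Q *m diag_mx mu ->
  exists k, `|mu 0 i - l 0 k| <=
    \sum_k \sum_j `|(invmx P *m (X - Y) *m P) k j|.
Proof.
move=> uP uQ YP XQ; set E := _ *m P.
(* The [i]-th eigenvector of [X] in the basis of the columns of [P]; row [k] of [E *m u] is then
   [(mu 0 i - l 0 k) * u k 0]. *)
pose u := col i (invmx P *m Q).
have [k0 u_neq0] : exists k, u k 0 != 0.
  apply/existsP; rewrite -[X in is_true X]negbK negb_exists.
  apply/negP => /forallP u0.
  have : u = 0.
    by apply/colP => k; rewrite [RHS]mxE; apply/eqP; move: (u0 k); rewrite negbK.
  rewrite /u colE => /(congr1 (mulmx (invmx Q *m P))).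
  rewrite mulmx0 -!mulmxA mulKVmx // mulKmx // => /matrixP /(_ i 0).
  by rewrite !mxE !eqxx => /eqP; rewrite oner_eq0.
have Eu : E *m u = mu 0 i *: u - diag_mx l *m u.
  have -> : diag_mx l *m u = invmx P *m Y *m (P *m u).
    by rewrite !mulmxA -(mulmxA _ Y) YP mulKmx.
  rewrite /E -mulmxA mulmxBr mulmxBl; congr (_ - _).
  rewrite /u colE -!mulmxA mulKVmx // (mulmxA X) XQ.
  rewrite !scalemxAr -!mulmxA; congr (_ *m (_ *m _)).
  apply/colP => k; rewrite mul_diag_mx !mxE eqxx andbT.
  by have [->|] := eqVneq k i; rewrite ?mulr0.
(* In the row where [u] is largest, [|u k 0|] dominates every [|u j 0|] and cancels. *)
pose k := [arg max_(k > k0) `|u k 0|]%O.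
have u_max j : `|u j 0| <= `|u k 0|.
  by rewrite /k; case: arg_maxP => // k' _; apply.
have uk_gt0 : 0 < `|u k 0|.
  by apply: lt_le_trans (u_max k0); rewrite normr_gt0.
exists k; rewrite -(ler_pM2r uk_gt0) -normrM.
have -> : (mu 0 i - l 0 k) * u k 0 = \sum_j E k j * u j 0.
  by rewrite mulrBl; have /colP /(_ k) := Eu; rewrite mul_diag_mx !mxE.
apply: le_trans (ler_norm_sum _ _ _) _.
apply: (@le_trans _ _ ((\sum_j `|E k j|) * `|u k 0|)).
  by rewrite mulr_suml; apply: ler_sum => j _; rewrite normrM ler_wpM2l.
rewrite ler_wpM2r // [leRHS](bigD1 k) //= lerDl.
by do 2 apply: sumr_ge0 => ? _.
Qed.

(** * Symplectic diagonalisation of -(JB)^2 *)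

Section Symplectic.
Variables (R : realType) (n : nat).
Local Notation J := (Jmx R n).
Implicit Types (M B : 'M[R]_(n + n)) (d : 'rV[R]_n).

Lemma mulJJ : J *m J = - 1%:M.
Proof.
rewrite /Jmx mulmx_block !(mul0mx, mulmx0, mul1mx, mulmx1, add0r, addr0).
by rewrite -[RHS]scaleN1r scalar_mx_block scale_block_mx !scaler0 scaleN1r.
Qed.

Lemma tr_Jmx : J^T = - J.
Proof.
rewrite /Jmx tr_block_mx !trmx0 linearN /= !trmx1 -[RHS]scaleN1r.
by rewrite scale_block_mx !scaler0 !scaleN1r opprK.
Qed.

Lemma symplectic_mulVmx M : symplectic M -> (- (J *m M^T *m J)) *m M = 1%:M.
Proof.
by move=> sM; rewrite mulNmx -!mulmxA (mulmxA M^T) sM mulJJ opprK.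
Qed.

Lemma symplectic_unit M : symplectic M -> M \in unitmx.
Proof. by move=> /symplectic_mulVmx /mulmx1_unit []. Qed.

(** The left inverse [- (J *m M^T *m J)] of [M] is also a right inverse, so the transpose of [M] is
    symplectic too. *)
Lemma symplectic_tr M : symplectic M -> M *m J *m M^T = J.
Proof.
move=> sM; have /mulmx1C := symplectic_mulVmx sM.
rewrite mulmxN !mulmxA => /(congr1 (mulmx^~ J)).
by rewrite mulNmx -(mulmxA _ J J) mulJJ mulmxN mulmx1 opprK mul1mx.
Qed.

Lemma mul_Dmx d d' : Dmx d *m Dmx d' = Dmx (\row_j (d 0 j * d' 0 j)).
Proof.
by rewrite /Dmx mulmx_block !(mul0mx, mulmx0, add0r, addr0) mulmx_diag.
Qed.

Lemma mul_JDmx d : J *m Dmx d = Dmx d *m J.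
Proof.
rewrite /Jmx /Dmx !mulmx_block !(mul0mx, mulmx0, mul1mx, mulmx1, add0r, addr0).
by rewrite mulNmx mulmxN mul1mx mulmx1.
Qed.

(* For positive definite B this matrix has the squared symplectic eigenvalues of B as
   its eigenvalues, each with doubled multiplicity. *)
Definition negsqJ B : 'M[R]_(n + n) := - (J *m B *m J *m B).

Definition sqrow d : 'rV[R]_(n + n) :=
  row_mx (\row_j d 0 j ^+ 2) (\row_j d 0 j ^+ 2).

Lemma symplectic_mulJ M B d : symplectic M -> M^T *m B *m M = Dmx d ->
  J *m B *m M = M *m (J *m Dmx d).
Proof.
by move=> sM MBM; rewrite -{1}(symplectic_tr sM) -!mulmxA -MBM !mulmxA.
Qed.

(** In the basis [M] the matrix [J *m B] becomes [J *m Dmx d]. Since [J] commutes with [Dmx d] and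
    squares to -1, minus the square is [Dmx d] squared. *)
Lemma negsqJ_diagonal M B d : symplectic M -> M^T *m B *m M = Dmx d ->
  negsqJ B *m M = M *m diag_mx (sqrow d).
Proof.
move=> sM MBM; have JBM := symplectic_mulJ sM MBM.
rewrite /negsqJ mulNmx -(mulmxA (J *m B) J B) -(mulmxA (J *m B) _ M) JBM mulmxA JBM.
rewrite -!mulmxA (mulmxA J (Dmx d)) {1}mul_JDmx !mulmxA -(mulmxA _ J J) mulJJ.
rewrite mulmxN mulmx1 !mulNmx opprK -!mulmxA mul_Dmx.
by rewrite /sqrow diag_mx_row /Dmx; congr (_ *m block_mx (diag_mx _) _ _ (diag_mx _));
   apply/rowP => j; rewrite !mxE expr2.
Qed.

End Symplectic.

(** * Differentials of matrix-valued maps *)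

Section MatrixDifferential.
Variables (R : realType) (V : normedModType R).
Implicit Types (x : V).

Lemma is_diff_big_sum (I : finType) (x : V) (f df : I -> V -> R^o) :
  (forall i, is_diff x (f i) (df i)) ->
  is_diff x (fun v => \sum_i f i v : R^o) (fun h => \sum_i df i h : R^o).
Proof.
move=> fdf; rewrite (_ : (fun v => _) = \sum_i f i); last first.
  by apply/funext => v; rewrite fct_sumE.
rewrite (_ : (fun h => _) = \sum_i df i); last first.
  by apply/funext => v; rewrite fct_sumE.
elim/big_ind2: _ => [|f1 df1 f2 df2 d1 d2|i _]; last exact: fdf.
- exact: is_diff_cst.
- exact: is_diffD.
Qed.

Lemma is_diff_lipschitz (x : V) (f df : V -> R^o) : is_diff x f df ->
  exists2 c, 0 < c & \forall y \near x, `|f y - f x| <= c * `|y - x|.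
Proof.
move=> fdf; have dfx : differentiable f x by exact: ex_diff.
have [k k_gt0 df_le] := linear_lipschitz (diff_continuous dfx).
(* [k] bounds the differential; the added 1 absorbs the remainder, which is at most [|h|] near 0. *)
exists (k + 1); first by rewrite addr_gt0.
have /eqaddoP /(_ 1 ltr01) := diff_locally dfx.
rewrite [X in _ -> X](near_shift 0) subr0.
apply: filterS => h /=; rewrite mul1r !fctE /= addrK => fh.
rewrite -[X in `|X|](subrK ('d f x h)) mulrDl mul1r addrC.
by apply: le_trans (ler_normD _ _) _; rewrite lerD // -addrA -opprD.
Qed.

(** The hypothesis is an expansion with zero linear part, and uniqueness of the differential then
    forces ['d f x] to be 0. *)
Lemma is_diff_littleo (x : V) (f : V -> R^o) : f x = 0 ->
  (forall e, 0 < e -> \forall y \near x, `|f y| <= e * `|y - x|) ->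
  is_diff x f (fun=> 0).
Proof.
move=> fx0 fle.
have f_o : f \o shift x = cst (f x) + (\0 : {linear V -> R^o}) +o_ 0 id.
  apply/eqaddoP => e e_gt0; move: (fle e e_gt0).
  rewrite [X in X -> _](near_shift 0) subr0; apply: filterS => h /=.
  by rewrite addrK !fctE fx0 /= addr0 subr0.
have d0 : 'd f x = 0 :> (V -> R^o).
  by apply: (@diff_unique _ _ _ _ (\0 : {linear V -> R^o})) f_o => y; apply: cvg_cst.
apply: DiffDef => //; apply/diff_locallyP; rewrite d0; split=> //.
by move=> y; apply: cvg_cst.
Qed.

(** Taken entrywise, so that the matrix product rule reduces to the rules for sums and products of
    real functions. *)
Definition is_mxdiff (m : nat) x (F dF : V -> 'M[R]_m) : Prop :=
  forall i j, is_diff x (fun v => F v i j : R^o) (fun h => dF h i j : R^o).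

Lemma is_mxdiff_cst (m : nat) x (C : 'M[R]_m) :
  is_mxdiff x (fun=> C) (fun=> 0).
Proof.
by move=> i j; apply: is_diff_eq; apply/funext => h; rewrite mxE.
Qed.

Lemma is_mxdiffD (m : nat) x (F G dF dG : V -> 'M[R]_m) :
  is_mxdiff x F dF -> is_mxdiff x G dG ->
  is_mxdiff x (fun v => F v + G v) (fun h => dF h + dG h).
Proof.
move=> FdF GdG i j; have := is_diffD (FdF i j) (GdG i j).
by congr is_diff_def; apply/funext => h; rewrite mxE.
Qed.

Lemma is_mxdiffN (m : nat) x (F dF : V -> 'M[R]_m) :
  is_mxdiff x F dF -> is_mxdiff x (fun v => - F v) (fun h => - dF h).
Proof.
move=> FdF i j; have := is_diffN (FdF i j).
by congr is_diff_def; apply/funext => h; rewrite mxE.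
Qed.

Lemma is_mxdiffM (m : nat) x (F G dF dG : V -> 'M[R]_m) :
  is_mxdiff x F dF -> is_mxdiff x G dG ->
  is_mxdiff x (fun v => F v *m G v) (fun h => dF h *m G x + F x *m dG h).
Proof.
move=> FdF GdG i j.
have := is_diff_big_sum (fun k => is_diffM (FdF i k) (GdG k j)).
congr is_diff_def; apply/funext => h; rewrite !mxE // -big_split /=.
by apply: eq_bigr => k _; rewrite addrC [dF h i k * _]mulrC.
Qed.

Lemma is_diff_mxtrace (m : nat) x (F dF : V -> 'M[R]_m) :
  is_mxdiff x F dF ->
  is_diff x (fun v => \tr (F v) : R^o) (fun h => \tr (dF h) : R^o).
Proof. by move=> FdF; apply: is_diff_big_sum => i; apply: FdF. Qed.

(* The derivative of a matrix polynomial is not q'(F) dF, because F and dF need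
   not commute, but it is so under the trace. *)
Lemma is_mxdiff_horner (m : nat) x (F dF : V -> 'M[R]_m.+1) (q : {poly R}) :
  is_mxdiff x F dF ->
  exists2 dq : V -> 'M[R]_m.+1,
    is_mxdiff x (fun v => horner_mx (F v) q) dq &
    forall Y h, comm_mx Y (F x) ->
      \tr (Y *m dq h) = \tr (Y *m horner_mx (F x) q^`() *m dF h).
Proof.
move=> FdF; elim/poly_ind: q => [|q c [dq Fdq tr_dq]].
  exists (fun=> 0) => [|Y h _]; last first.
    by rewrite [0^`()]linear0 rmorph0 !mulmx0 mul0mx.
  have := is_mxdiff_cst x (0 : 'M[R]_m.+1); congr is_mxdiff.
  by apply/funext => v; rewrite rmorph0.
exists (fun h => dq h *m F x + horner_mx (F x) q *m dF h) => [|Y h YF].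
  have := is_mxdiffD (is_mxdiffM Fdq FdF) (is_mxdiff_cst x c%:M).
  congr is_mxdiff; apply/funext => v; last by rewrite addr0.
  by rewrite rmorphD rmorphM /= horner_mx_X horner_mx_C.
(* By cyclicity the trailing [F x] moves next to [Y], and the induction hypothesis is used at
   [Y *m F x]; this is why the claim is made for all [Y] commuting with [F x]. *)
have comF : comm_mx (Y *m F x) (F x) by rewrite /comm_mx mulmxA -YF.
rewrite derivD derivM derivX derivC addr0 mulr1 rmorphD rmorphM /= horner_mx_X.
rewrite !mulmxDr mulmxDl !mxtraceD !mulmxA; congr (_ + _).
rewrite mxtrace_mulC mulmxA -YF tr_dq //.
rewrite -!mulmxA; congr (\tr (_ *m _)); rewrite !mulmxA; congr (_ *m _).
exact: comm_mx_horner.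
Qed.

End MatrixDifferential.

Lemma normr_entry_le_frobenius (R : realType) (m : nat) (A : symmx R m) i j :
  `|symval A i j| <= `|A|.
Proof.
rewrite -[`|A|]/(frobenius A) /frobenius innerE -sqrtr_sqr ler_wsqrtr //.
rewrite (bigD1 j) //= (bigD1 i) //= -addrA lerDl addr_ge0 //.
  by apply: sumr_ge0 => ? _; apply: sqr_ge0.
by do 2 apply: sumr_ge0 => ? _; apply: sqr_ge0.
Qed.

(** Each entry is a linear form bounded by the Frobenius norm, hence continuous and its own
    differential. *)
Lemma is_mxdiff_symval (R : realType) (m : nat) (A : symmx R m) :
  is_mxdiff A (@symval R m) (@symval R m).
Proof.
move=> i j; pose f (B : symmx R m) : R^o := symval B i j.
have flin : linear f by move=> c B C; rewrite /f /= !mxE.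
pose fM := GRing.isLinear.Build _ _ _ _ f flin.
pose fL : {linear symmx R m -> R^o} := HB.pack f fM.
have fc : continuous fL.
  apply: bounded_linear_continuous; apply/bounded_funP => r; exists r => B.
  by apply: le_trans; apply: normr_entry_le_frobenius.
apply: DiffDef; first exact: (linear_differentiable A fc).
exact: (diff_lin A fc).
Qed.

(** * Perturbation of symplectic eigenvalues and gradients of trace functions *)

Lemma sqrow_lshift (R : realType) (n : nat) (d : 'rV[R]_n) j :
  sqrow d 0 (lshift n j) = d 0 j ^+ 2.
Proof. by rewrite /sqrow row_mxEl mxE. Qed.

Lemma sqrow_rshift (R : realType) (n : nat) (d : 'rV[R]_n) j :
  sqrow d 0 (rshift n j) = d 0 j ^+ 2.
Proof. by rewrite /sqrow row_mxEr mxE. Qed.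

Lemma sqrow_ex (R : realType) (n : nat) (d : 'rV[R]_n) k :
  exists j, sqrow d 0 k = d 0 j ^+ 2.
Proof.
by case: (split_ordP k) => j ->; exists j; rewrite ?sqrow_lshift ?sqrow_rshift.
Qed.

(** Bauer-Fike in the eigenbasis [M] of [negsqJ A]. No matching of [k] with [j] is claimed;
    closeness to some [d 0 k] suffices, because the interpolation is exact to first order at all of
    them. *)
Lemma symp_spectrum_perturbation (R : realType) (n : nat)
    (A B M N : 'M[R]_(n + n)) (d e : 'rV[R]_n) (j : 'I_n) :
  symplectic M -> M^T *m A *m M = Dmx d ->
  symplectic N -> N^T *m B *m N = Dmx e ->
  exists k, `|e 0 j ^+ 2 - d 0 k ^+ 2| <=
    \sum_k \sum_j `|(invmx M *m (negsqJ B - negsqJ A) *m M) k j|.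
Proof.
move=> sM MAM sN NBN.
have [k] := bauer_fike (lshift n j) (symplectic_unit sM) (symplectic_unit sN)
  (negsqJ_diagonal sM MAM) (negsqJ_diagonal sN NBN).
by have [i ->] := sqrow_ex d k; rewrite sqrow_lshift; exists i.
Qed.

(* horner_mx requires the dimension to be a successor: n.+1 + n.+1 is convertible
   to (n + n.+1).+1. *)
Lemma half_mxtrace_horner (R : realType) (n : nat) (q : {poly R})
    (M B : 'M[R]_(n.+1 + n.+1)) (d : 'rV[R]_n.+1) :
  symplectic M -> M^T *m B *m M = Dmx d ->
  2^-1 * \tr (horner_mx (negsqJ B : 'M[R]_((n + n.+1).+1)) q)
  = \sum_j q.[d 0 j ^+ 2].
Proof.
move=> sM MBM; have uM := symplectic_unit sM.
have := horner_mx_diagonal q (negsqJ_diagonal sM MBM : @eq 'M[R]_((n + n.+1).+1) _ _).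
move=> /(congr1 (mulmx^~ (invmx M))); rewrite (mulmxK uM) => ->.
rewrite mxtrace_mulC mulmxA (mulVmx uM) mul1mx mxtrace_diag.
rewrite (@big_split_ord _ _ _ n.+1 n.+1) /=.
rewrite [X in X + _](eq_bigr (fun j => q.[d 0 j ^+ 2])) => [|j _]; last first.
  by rewrite mxE; congr _.[_]; apply: sqrow_lshift.
rewrite [X in _ + X](eq_bigr (fun j => q.[d 0 j ^+ 2])) => [|j _]; last first.
  by rewrite mxE; congr _.[_]; apply: sqrow_rshift.
by field.
Qed.

(** Both factors are diagonal in terms of [M]: the polynomial acts on [M] through its values at the
    [d 0 j ^+ 2], and J A J = - M D_d M^T. *)
Lemma horner_negsqJ_gradient (R : realType) (n : nat) (q : {poly R})
    (M A : 'M[R]_(n.+1 + n.+1)) (d : 'rV[R]_n.+1) :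
  symplectic M -> M^T *m A *m M = Dmx d ->
  horner_mx (negsqJ A : 'M[R]_((n + n.+1).+1)) q *m (Jmx R n.+1 *m A *m Jmx R n.+1)
  = - (M *m Dmx (\row_j (q.[d 0 j ^+ 2] * d 0 j)) *m M^T).
Proof.
move=> sM MAM; have uM := symplectic_unit sM.
pose r := \row_j q.[d 0 j ^+ 2].
have qM : horner_mx (negsqJ A : 'M[R]_((n + n.+1).+1)) q *m M = M *m Dmx r.
  have := horner_mx_diagonal q (negsqJ_diagonal sM MAM : @eq 'M[R]_((n + n.+1).+1) _ _).
  move=> ->; congr (_ *m _); rewrite /Dmx -diag_mx_row.
  have : map_mx (horner q) (sqrow d) = row_mx r r.
    by rewrite map_row_mx; congr row_mx; apply/rowP => j; rewrite !mxE.
  exact: congr1.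
have -> : Jmx R n.+1 *m A *m Jmx R n.+1 = - (M *m (Dmx d *m M^T)).
  rewrite -{2}(symplectic_tr sM) !mulmxA (symplectic_mulJ sM MAM).
  rewrite mul_JDmx !mulmxA -(mulmxA _ (Jmx _ _) (Jmx _ _)) mulJJ.
  by rewrite mulmxN mulmx1 mulNmx.
rewrite mulmxN (mulmxA _ M) qM -!mulmxA (mulmxA (Dmx r)) mul_Dmx.
by congr (- (_ *m (Dmx _ *m _))); apply/rowP => j; rewrite !mxE.
Qed.

Lemma is_mxdiff_negsqJ (R : realType) (n : nat) (A : symmx R (n + n)) :
  is_mxdiff A (fun B => negsqJ (symval B))
    (fun H => - (Jmx R n *m symval H *m (Jmx R n *m symval A)
               + Jmx R n *m symval A *m (Jmx R n *m symval H))).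
Proof.
have JH := is_mxdiffM (is_mxdiff_cst A (Jmx R n)) (is_mxdiff_symval A).
have := is_mxdiffN (is_mxdiffM JH JH).
congr is_mxdiff; apply/funext => B; first by rewrite /negsqJ !mulmxA.
by rewrite mul0mx add0r.
Qed.

Lemma tr_symval (R : realType) (m : nat) (A : symmx R m) :
  (symval A)^T = symval A.
Proof. by have := valP A; rewrite unfold_in => /eqP. Qed.

(** With X = -(JA)^2, the derivative along H is minus half the trace of q'(X) (JHJA + JAJH). As JA
    commutes with q'(X), cyclicity makes the two terms equal, which leaves - tr (q'(X) J A J H). *)
Lemma is_gradient_half_mxtrace (R : realType) (n : nat) (q : {poly R})
    (A G : symmx R (n.+1 + n.+1)) (M : 'M[R]_(n.+1 + n.+1)) (d : 'rV[R]_n.+1) :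
  symplectic M -> M^T *m symval A *m M = Dmx d ->
  symval G = M *m Dmx (\row_j (q^`().[d 0 j ^+ 2] * d 0 j)) *m M^T ->
  is_gradient (fun B : symmx R (n.+1 + n.+1) => 2^-1 *
    \tr (horner_mx (negsqJ (symval B) : 'M[R]_((n + n.+1).+1)) q) : R^o) A G.
Proof.
move=> sM MAM GE; rewrite /is_gradient.
have [dq qdq tr_dq] := is_mxdiff_horner q
  (is_mxdiff_negsqJ A : is_mxdiff (m := (n + n.+1).+1) _ _ _).
have := is_diffZ 2^-1 (is_diff_mxtrace qdq).
congr is_diff_def; apply/funext => H.
rewrite fctE /inner.
rewrite tr_symval.
have /= := tr_dq 1%:M H (comm_mx_sym (comm_mx1 _)); rewrite !mul1mx => ->.
have := horner_negsqJ_gradient q^`() sM MAM; set Q := horner_mx _ _ => QE.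
rewrite GE -[_ *m M^T]opprK -QE.
have JAQ : Jmx R n.+1 *m symval A *m Q = Q *m (Jmx R n.+1 *m symval A).
  have : comm_mx (Jmx R n.+1 *m symval A : 'M[R]_((n + n.+1).+1)) Q.
    apply: comm_mx_horner; rewrite /comm_mx /negsqJ mulmxN mulNmx.
    by rewrite !mulmxA.
  by [].
rewrite mulmxN mulmxDr linearN /= mxtraceD mulNmx [RHS]linearN /=.
set t := \tr (Q *m _ *m symval H).
have -> : \tr (Q *m (Jmx R n.+1 *m symval A *m (Jmx R n.+1 *m symval H))) = t.
  by rewrite /t !mulmxA.
have -> : \tr (Q *m (Jmx R n.+1 *m symval H *m (Jmx R n.+1 *m symval A))) = t.
  by rewrite (mulmxA Q) mxtrace_mulC (mulmxA _ Q) JAQ /t !mulmxA.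
by rewrite -[LHS]/(2^-1 * - (t + t)); field.
Qed.

(** * The entropy of one mode and its derivative *)

Definition renyi_term (R : realType) (p t : R) : R :=
  1 / (1 - p) * log2 (2 `^ p / ((t + 1) `^ p - (t - 1) `^ p)).

(** The derivative of [renyi_term p]; at [t = d 0 j] it is the [j]-th entry of [renyi_weight]. *)
Definition renyi_slope (R : realType) (p t : R) : R :=
  p / ((p - 1) * ln 2) *
  (((t + 1) `^ (p - 1) - (t - 1) `^ (p - 1)) / ((t + 1) `^ p - (t - 1) `^ p)).

Lemma is_derive_renyi_term (R : realType) (p t : R) : 1 < p -> 1 < t ->
  is_derive t 1 (renyi_term p) (renyi_slope p t).
Proof.
move=> p_gt1 t_gt1; pose b (s : R) := (s + 1) `^ p - (s - 1) `^ p.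
have p_gt0 : 0 < p by lra.
have b_gt0 : 0 < b t.
  by rewrite subr_gt0 gt0_ltr_powR // ?nnegrE; lra.
have ln2_neq0 : ln 2 != 0 :> R by rewrite gt_eqF // ln_gt0 // ltr1n.
have db c : 0 < t + c ->
    is_derive t 1 (fun s => (s + c) `^ p) (p * (t + c) `^ (p - 1)).
  move=> tc; have tc1 : is_derive t 1 (fun s => s + c) 1.
    by apply: is_derive_eq; rewrite addr0.
  have := is_derive1_comp (g := fun s => s + c) (is_derive1_powR p tc) tc1.
  by rewrite mulr1.
have dbt : is_derive t 1 b (p * (t + 1) `^ (p - 1) - p * (t - 1) `^ (p - 1)).
  by apply: is_deriveB; apply: db; lra.
have dlnb := is_derive1_comp (is_derive1_ln b_gt0) dbt.
have := is_deriveB (is_derive_cst (ln (2 `^ p)) t 1) dlnb.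
move=> /(is_deriveZ ((1 - p)^-1 / ln 2)) dg.
have : is_derive t 1 (fun s => (1 - p)^-1 / ln 2 * (ln (2 `^ p) - ln (b s)))
    (renyi_slope p t).
  apply: (is_derive_eq dg); rewrite sub0r -[LHS]/(_ * _) /renyi_slope.
  rewrite -/(b t) invfM; field.
  by rewrite ln2_neq0 gt_eqF //=; lra.
(* The logarithm of the quotient splits where [b] is positive, hence near [t] by continuity. *)
apply: near_eq_is_derive.
have bc : {for t, continuous b}.
  by apply: differentiable_continuous; apply/derivable1_diffP; apply: ex_derive.
have : \forall s \near t, 0 < b s by exact: (cvgr_gt (b t) bc).
apply: filterS => s bs.
rewrite /renyi_term /log2 -/(b s) ln_div ?posrE ?powR_gt0 //.
by rewrite -[RHS]/(_ * _) div1r mulrA mulrAC.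
Qed.

Lemma is_derive_0_littleo (R : realType) (f : R -> R) (x e : R) : 0 < e ->
  is_derive x 1 f 0 -> f x = 0 ->
  exists2 r, 0 < r & forall y, `|y - x| < r -> `|f y| <= e * `|y - x|.
Proof.
move=> e_gt0 [df dfx] fx.
have /eqaddoP /(_ e e_gt0) := derivable_nbhs df.
move=> /nbhs_ballP [r r_gt0 fr]; exists r => // y yr.
have := fr (y - x); rewrite /ball /= sub0r normrN => /(_ yr).
by rewrite !fctE /= dfx fx scaler0 addr0 subr0 -[_ *: 1]/(_ * 1) mulr1 subrK.
Qed.

(** * Symplectic spectra on the Gaussian set and in its interior *)

Lemma gaussian_symp_spectrum (R : realType) (n : nat) (B : symmx R (n + n)) :
  (0 < n)%N -> gaussian R n B -> is_symp_spectrum B (symp_spectrum B).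
Proof.
move=> n_gt0 [_ d_ge1]; apply: xgetPex; apply: contrapT => nex.
have := d_ge1 (Ordinal n_gt0); rewrite /symp_spectrum xgetPN.
  by rewrite mxE ler10.
by move=> d Bd; apply: nex; exists d.
Qed.

Lemma gaussian_interior_gt1 (R : realType) (n : nat) (A : symmx R (n + n)) j :
  (gaussian R n)° A -> 1 < symp_spectrum A 0 j.
Proof.
move=> A_in; have n_gt0 : (0 < n)%N := leq_ltn_trans (leq0n j) (ltn_ord j).
have gA := interior_subset A_in.
have [d_gt0 _ [M sM MAM]] := gaussian_symp_spectrum n_gt0 gA.
have [c /andP[c_gt0 c_lt1] gc] : exists2 c : R, 0 < c < 1 & gaussian R n (c *: A).
  have : \forall c \near (1 : R), gaussian R n (c *: A).
    by apply: (@scalel_continuous R _ A 1); rewrite scale1r.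
  move=> /nbhs_ballP [r r_pos gr]; have r_gt0 : 0 < r := r_pos.
  (* The scale [c] must lie within [r] of 1 and stay positive: [1 - r / 2] works for small [r], and
     1/2 otherwise. *)
  have [r1|r1] := ltP r 1.
    exists (1 - r / 2); first by apply/andP; split; lra.
    by apply: gr; rewrite /ball /= (_ : 1 - _ = r / 2); [rewrite gtr0_norm|]; lra.
  exists (1 / 2); first by apply/andP; split; lra.
  by apply: gr; rewrite /ball /= gtr0_norm; lra.
have [_ _ [N sN NAN]] := gaussian_symp_spectrum n_gt0 gc.
have [_ e_ge1] := gc.
have cA : M^T *m symval (c *: A) *m M = Dmx (c *: symp_spectrum A).
  rewrite /= -scalemxAr -scalemxAl MAM /Dmx scale_block_mx !scaler0.
  by rewrite !linearZ.
(* Both matrices are [c *: A], so the perturbation bound is 0: [c * d_j] has the same square as an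
   entry of the chosen spectrum of [c *: A], which is at least 1. *)
have [k] := symp_spectrum_perturbation j sN NAN sM cA.
rewrite subrr mulmx0 mul0mx big1 => [|i _]; last first.
  by apply: big1 => l _; rewrite mxE normr0.
rewrite normr_le0 subr_eq0 mxE => /eqP cd.
have := e_ge1 k; have := d_gt0 j; move: cd.
set a := symp_spectrum A 0 j; set b := symp_spectrum _ 0 k => cd a_gt0 b_ge1.
rewrite ltNge; apply/negP => a_le1.
have ca_ge0 : 0 <= c * a by rewrite mulr_ge0 ?ltW.
have ca_lt1 : c * a < 1 by nra.
have ca2 : (c * a) ^+ 2 < 1 by rewrite expr_lt1.
by move: ca2; rewrite cd expr_lt1 ?(le_trans ler01) // ltNge b_ge1.
Qed.

(** * The gradient of the entropy *)

Lemma is_mxdiff_lipschitz (R : realType) (V : normedModType R) (m : nat) (x : V)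
    (F dF : V -> 'M[R]_m) : is_mxdiff x F dF ->
  exists2 c, 0 < c & \forall y \near x,
    \sum_i \sum_j `|(F y - F x) i j| <= c * `|y - x|.
Proof.
move=> FdF.
have /choice [c cP] : forall ij : 'I_m * 'I_m, exists c, 0 < c /\
    \forall y \near x, `|F y ij.1 ij.2 - F x ij.1 ij.2| <= c * `|y - x|.
  by case=> i j; have [c c_gt0 cF] := is_diff_lipschitz (FdF i j); exists c.
exists (1 + \sum_i \sum_j c (i, j)).
  rewrite ltr_pwDl //; do 2 apply: sumr_ge0 => ? _.
  by apply: ltW; apply: (cP _).1.
have : \forall y \near x, forall ij : 'I_m * 'I_m,
    `|F y ij.1 ij.2 - F x ij.1 ij.2| <= c ij * `|y - x|.
  by apply: filter_forall => ij; apply: (cP ij).2.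
apply: filterS => y Fy.
rewrite mulrDl mul1r ler_wpDl // mulr_suml; apply: ler_sum => i _.
rewrite mulr_suml; apply: ler_sum => j _.
by have := Fy (i, j); rewrite !mxE.
Qed.
Lemma is_gradient_renyi (R : realType) (n : nat) (p : R)
    (A G : symmx R (n.+1 + n.+1)) (M : 'M[R]_(n.+1 + n.+1)) :
  1 < p -> (gaussian R n.+1)° A -> SPup A M ->
  symval G = 2^-1 *: (M *m Dmx (renyi_weight p A) *m M^T) ->
  is_gradient (@renyi R n.+1 p) A G.
Proof.
move=> p_gt1 A_in [sM MAM] GE; set d := symp_spectrum A in MAM.
have d_gt1 j : 1 < d 0 j by apply: gaussian_interior_gt1.
have sqrtd j : Num.sqrt (d 0 j ^+ 2) = d 0 j.
  by rewrite sqrtr_sqr gtr0_norm // (lt_trans ltr01).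
(* In the variable x = t^2 the slope to match is g'(t) / (2 t), by the chain rule. The factor 1/2 of
   the gradient formula comes from here. *)
have [q qP] := hermite_interpolation [seq d 0 j ^+ 2 | j <- enum 'I_n.+1]
  (fun x => renyi_term p (Num.sqrt x))
  (fun x => renyi_slope p (Num.sqrt x) / (2 * Num.sqrt x)).
have {qP} qd j : q.[d 0 j ^+ 2] = renyi_term p (d 0 j) /\
    q^`().[d 0 j ^+ 2] = renyi_slope p (d 0 j) / (2 * d 0 j).
  have := qP (d 0 j ^+ 2); rewrite sqrtd; apply.
  by apply/mapP; exists j; rewrite ?mem_enum.
pose phi (B : symmx R (n.+1 + n.+1)) : R^o := 2^-1 *
  \tr (horner_mx (negsqJ (symval B) : 'M[R]_((n + n.+1).+1)) q).
have dphi : is_gradient phi A G.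
  apply: (is_gradient_half_mxtrace sM MAM).
  rewrite GE scalemxAl scalemxAr /Dmx scale_block_mx !scaler0 -!linearZ /=.
  congr (_ *m block_mx (diag_mx _) _ _ (diag_mx _) *m _);
    apply/rowP => j; rewrite !mxE (qd j).2 -/d -/(renyi_slope p (d 0 j));
    by field; rewrite gt_eqF // (lt_trans ltr01).
(* The interpolation error of one mode; its value and derivative vanish at every [d 0 j]. *)
pose u t := renyi_term p t - q.[t ^+ 2].
have renyiE B N : gaussian R n.+1 B -> symplectic N ->
    N^T *m symval B *m N = Dmx (symp_spectrum B) ->
    renyi p B - phi B = \sum_j u (symp_spectrum B 0 j).
  move=> gB sN NBN; rewrite /renyi mem_set // /phi.
  by rewrite (half_mxtrace_horner q sN NBN) -sumrB.
have gA := interior_subset A_in.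
have ud j : u (d 0 j) = 0 by rewrite /u (qd j).1 subrr.
have du j : is_derive (d 0 j) 1 u 0.
  have d2 : is_derive (d 0 j) 1 (fun t : R => t ^+ 2) (2 * d 0 j).
    apply: (is_derive_eq (is_deriveX 2 (is_derive_id (d 0 j) (1 : R)))).
    by rewrite -[LHS]/(_ * _) mulr1.
  have dq := is_derive1_comp (g := fun t : R => t ^+ 2)
    (is_derive_poly q (d 0 j ^+ 2)) d2.
  apply: (is_derive_eq (is_deriveB (is_derive_renyi_term p_gt1 (d_gt1 j)) dq)).
  rewrite (qd j).2; field.
  by rewrite gt_eqF // (lt_trans ltr01).
have rho_diff : is_diff A (fun B => renyi p B - phi B : R^o) (fun=> 0).
  apply: is_diff_littleo => [|e e_gt0].
    by rewrite (renyiE A M) // big1.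
  have dX := is_mxdiffM (is_mxdiffM (is_mxdiff_cst A (invmx M))
    (is_mxdiff_negsqJ A)) (is_mxdiff_cst A M).
  have [c c_gt0 cX] := is_mxdiff_lipschitz dX.
  (* Chosen so that [n.+1] errors of size [e' * (c * |B - A|)] add up to [e * |B - A|]. *)
  pose e' := e / (c * n.+1%:R).
  have e'_gt0 : 0 < e' by rewrite divr_gt0 // mulr_gt0.
  have near_u (k : 'I_n.+1) : \forall B \near A, forall t, 1 <= t ->
      `|t ^+ 2 - d 0 k ^+ 2| <= c * `|B - A| -> `|u t| <= e' * (c * `|B - A|).
    have [r r_gt0 ur] := is_derive_0_littleo e'_gt0 (du k) (ud k).
    apply/nbhs_normP; exists (r / c) => [|B]; first exact: divr_gt0.
    rewrite /= distrC ltr_pdivlMr // mulrC => Br t t_ge1 td.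
    (* Since [t + d 0 k] is at least 1, the bound on the difference of squares passes to
       [t - d 0 k]. *)
    have tdB : `|t - d 0 k| <= c * `|B - A|.
      apply: le_trans td; rewrite subr_sqr normrM ler_peMr //.
      by rewrite ger0_norm; have := d_gt1 k; lra.
    apply: le_trans (ur _ (le_lt_trans tdB Br)) _.
    by rewrite ler_pM2l.
  have gnear : \forall B \near A, gaussian R n.+1 B by exact: A_in.
  near=> B.
  have gB : gaussian R n.+1 B by near: B.
  have [_ _ [N sN NBN]] := gaussian_symp_spectrum (ltn0Sn n) gB.
  rewrite (renyiE B N) //; apply: le_trans (ler_norm_sum _ _ _) _.
  have -> : e * `|B - A| = \sum_(j < n.+1) e' * (c * `|B - A|).
    rewrite sumr_const card_ord -mulr_natl /e'; field.
    by rewrite gt_eqF //= gt_eqF.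
  apply: ler_sum => j _.
  have [k dk] := symp_spectrum_perturbation j sM MAM sN NBN.
  (* The index [k] depends on [B], so the neighbourhoods of all [k] are intersected. *)
  have near_uB : forall k t, 1 <= t ->
      `|t ^+ 2 - d 0 k ^+ 2| <= c * `|B - A| -> `|u t| <= e' * (c * `|B - A|).
    by near: B; apply: filter_forall; apply: near_u.
  apply: (near_uB k); first exact: gB.2.
  apply: le_trans dk _; rewrite mulmxBr mulmxBl.
  by near: B.
have := is_diffD dphi rho_diff; rewrite /is_gradient.
by congr is_diff_def; apply/funext => B; rewrite fctE ?addr0 // addrC subrK.
Unshelve. all: by end_near. Qed.

Theorem mainTheorem7 (R : realType) (n : nat) (p : R)
    (n_gt0 : (0 < n)%N) (p_gt1 : 1 < p)
    (A : symmx R (n + n)) (A_in : (gaussian R n)° A) :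
  differentiable (@renyi R n p) A /\
  forall M : 'M[R]_(n + n), SPup A M ->
    exists2 G : symmx R (n + n),
      symval G = 2^-1 *: (M *m Dmx (renyi_weight p A) *m M^T) &
      is_gradient (@renyi R n p) A G.
Proof.
have grad M : SPup A M -> exists2 G : symmx R (n + n),
    symval G = 2^-1 *: (M *m Dmx (renyi_weight p A) *m M^T) &
    is_gradient (@renyi R n p) A G.
  move=> spM; have G_sym : 2^-1 *: (M *m Dmx (renyi_weight p A) *m M^T)
      \in @issym R (n + n).
    rewrite unfold_in linearZ /= !trmx_mul trmxK mulmxA.
    by rewrite /Dmx tr_block_mx !trmx0 !tr_diag_mx.
  exists (SymMx G_sym) => //.
  by case: n n_gt0 A A_in M spM G_sym => // m _ A A_in M spM G_sym;
     apply: (is_gradient_renyi p_gt1 A_in spM).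
split=> //.
(* Differentiability needs some [M] in [SPup A]; the spectrum of a Gaussian [A] supplies one. *)
have [_ _ [M sM MAM]] := gaussian_symp_spectrum n_gt0 (interior_subset A_in).
have [G _ dG] := grad M (conj sM MAM).
by case: dG.
Qed.
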